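(* $\mathcal{N}'_U\setminus \mathrm{Diag}\subseteq \overline{\mathcal{N}^{\mathrm{o}}}$, where $\mathcal{N}^{\mathrm{o}}$ denotes the interior of $\mathcal{N}$ in $\mathbb{R}^2$ and the bar denotes closure in $\mathbb{R}^2$.
   Context: $\mathcal{B}=\{1+\sum_{n=1}^{\infty}a_nx^n : a_n\in\{-1,0,1\}\}$, a set of power series converging on $(-1,1)$. $\mathcal{N}=\{(\gamma,\lambda)\in(-1,1)^2:\text{ there exists } f\in\mathcal{B} \text{ with } f(\gamma)=f(\lambda)=0\}$ and $\mathrm{Diag}=\{(\lambda,\lambda):\lambda\in(-1,1)\}$. A zero $\lambda$ of $f$ is a sign change for $f$ if $f$ is nonzero with opposite signs immediately to the left and immediately to the right of $\lambda$. $\mathcal{N}'$ is the set of all $(\gamma,\lambda)\in(-1,1)^2$ for which there exists $f\in\mathcal{B}$ with $f(\gamma)=f(\lambda)=0$ such that both $\gamma$ and $\lambda$ are sign changes for $f$. Property U: let $f:[a,b]\to\mathbb{R}$ be a real power series with an isolated zero $\lambda\in(a,b)$, and let $f_n$ be the truncation of $f$ to a polynomial of degree at most $n$. Then $f$ satisfies property U around $\lambda$ if for every sufficiently small $\epsilon>0$ there exists $N$ such that for all $n>N$, $f_n$ has a unique zero $\lambda_n$ in $B(\lambda,\epsilon)=(\lambda-\epsilon,\lambda+\epsilon)$, and this neighborhood contains no critical points of $f_n$ except possibly $\lambda_n$ itself. $\mathcal{N}'_U$ is the set of all $(\gamma,\lambda)\in\mathcal{N}'$ such that there exists $f\in\mathcal{B}$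 with $f(\gamma)=f(\lambda)=0$ and such that $f$ satisfies property U around both $\gamma$ and $\lambda$. *)

(* Defs.v *)
From HB Require Import structures.
From mathcomp Require Import all_boot all_order all_algebra.
From mathcomp Require Import all_classical all_reals all_analysis.

Set Implicit Arguments.
Unset Strict Implicit.
Unset Printing Implicit Defensive.
Import Order.TTheory GRing.Theory Num.Theory.
Import numFieldNormedType.Exports.

Local Open Scope classical_set_scope.
Local Open Scope ring_scope.

(* A power series is represented by its sequence of coefficients.  The value
   [psum a x] is meaningful only where [pseries a x] converges. *)
Definition psum (R : realType) (a : R^nat) (x : R) : R := limn (pseries a x).

Definition truncp (R : realType) (a : R^nat) (n : nat) : {poly R} :=
  \poly_(i < n.+1) a i.

Definition classB (R : realType) : set R^nat :=
  [set a | a 0%N = 1 /\ forall n, a n.+1 \in [:: -1; 0; 1]].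

Definition sign_change (R : realType) (f : R -> R) (l : R) : Prop :=
  ((\forall x \near l^'-, f x < 0) /\ (\forall x \near l^'+, 0 < f x)) \/
  ((\forall x \near l^'-, 0 < f x) /\ (\forall x \near l^'+, f x < 0)).

(* The first conjunct says that the series is defined on some [lo, hi] with
   lo < l < hi.  Critical points of a truncation are the roots of its
   derivative. *)
Definition property_U (R : realType) (a : R^nat) (l : R) : Prop :=
  [/\ \forall x \near l, cvgn (pseries a x),
      isolated [set x | psum a x = 0] l &
      \forall e \near 0^'+, exists N : nat, forall n : nat, (N < n)%N ->
        exists ln : R,
          [/\ ball l e ln,
              root (truncp a n) ln,
              (forall x, ball l e x -> root (truncp a n) x -> x = ln) &
              (forall x, ball l e x -> root (truncp a n)^`() x -> x = ln)]].

Definition open_square (R : realType) : set (R * R) :=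
  `]-1, 1[%classic `*` `]-1, 1[%classic.
Arguments open_square R : clear implicits.

Definition setN (R : realType) : set (R * R) :=
  open_square R `&`
  [set p | exists a : R^nat, [/\ classB a, psum a p.1 = 0 & psum a p.2 = 0]].
Arguments setN R : clear implicits.

Definition Diag (R : realType) : set (R * R) :=
  open_square R `&` [set p | p.1 = p.2].
Arguments Diag R : clear implicits.

Definition setN' (R : realType) : set (R * R) :=
  open_square R `&`
  [set p | exists a : R^nat,
    [/\ classB a, psum a p.1 = 0, psum a p.2 = 0,
        sign_change (psum a) p.1 & sign_change (psum a) p.2]].
Arguments setN' R : clear implicits.

(* The series witnessing property U need not be the one that witnesses
   membership in [setN']. *)
Definition setN'_U (R : realType) : set (R * R) :=
  setN' R `&`
  [set p | exists a : R^nat,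
    [/\ classB a, psum a p.1 = 0, psum a p.2 = 0,
        property_U a p.1 & property_U a p.2]].
Arguments setN'_U R : clear implicits.

(* Main.v *)
Require Import Defs.
From mathcomp Require Import all_boot all_order all_algebra.
From mathcomp Require Import all_classical all_reals all_analysis.
From mathcomp Require Import ring lra.
Import numFieldNormedType.Exports.
Import Order.TTheory GRing.Theory Num.Theory.
Local Open Scope classical_set_scope.
Local Open Scope ring_scope.

(** Let [g] be the series that vanishes with a sign change at two distinct
    points [gam] and [lam].  Keep the truncation [g_n] and replace the rest by
    [x^(n+1) h], where [h] has coefficients in {-1, 0, 1}: the new series
    vanishes at a pair [(x, y)] as soon as [(h(x), h(y))] equals the pair of
    values of [- g_n(t) / t^(n+1)] at [t = x] and [t = y].  Hence a pair
    [(w1, w2)] which is attained as [(h(x), h(y))] in a stable manner, that is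
    for all [(x, y)] near [(gam, lam)] and all targets near [(w1, w2)], gives
    interior points of [setN]: because of the sign changes, the intermediate
    value theorem provides, for every large [n], a pair [(x, y)] close to
    [(gam, lam)] with [g_n(x) = - w1 x^(n+1)] and [g_n(y) = - w2 y^(n+1)], and
    for the pairs near that one the required targets remain near [(w1, w2)].

    A weaker form of stability suffices, called [trap] below: if some series
    of class B has modulus at most [e] at [x] and at [y], then the target is
    attained up to [C e].  Grafting multiplies this error by at most
    [q^(n+1)] with [q < 1], so for [n] large the bound [e] can be halved again
    and again, and a compactness argument gives an exact common zero
    ([setN_of_halving]).

    To find a trap, consider the set of points [(f(x), f(y))] where the
    coefficients of [f] are 0 or 1.  It is the attractor of two affine
    contractions, and a class B series with modulus at most [e] at [x] and [y]
    says that its two pieces are within [e] of each other; self-similarity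
    then links any two of its points by a chain with steps at most [e]
    ([near_zero_linked]).  If [gam] and [lam] have different absolute values,
    the linear form [f(gam) - f(lam)] attains its maximum on this attractor at
    exactly two points, which differ by [(1, 1)] (lemma [face_isolated] is a
    quantitative version that holds near [(gam, lam)]).  Join the two points by a
    chain, and translate the chain by half of [(1, 1)]: the four ends
    interleave on the boundary of a half-plane which contains both chains, so
    the chains have to come close to each other ([chain_meets_translate], a
    discrete planar crossing argument).  A near-coincidence is a difference of
    two 0-1 series, that is a series [h], whose values are close to
    [(1/2, 1/2)].

    If [lam = - gam], then splitting a common zero into even and odd parts
    shows that the square of [gam] is at least [1/2].  This is so large that
    expansions with digits -1, 0, 1 reach every point near the origin, by a
    greedy algorithm that survives perturbation ([antidiagonal_trap]). *)
Section SignChangePairs.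
Variable R : realType.
Implicit Types (f g h : R^nat) (a b : nat -> bool) (x y z q e gam lam rho : R).

(** * Power series with bounded coefficients *)
Definition unit_bounded f := forall n, `|f n| <= 1.

Definition ternary f := forall n, f n \in [:: -1; 0; 1].

Definition tail n f : R^nat := fun k => f (n + k)%N.

Lemma ternary_unit_bounded f : ternary f -> unit_bounded f.
Proof.
move=> ha n; have := ha n; rewrite !inE => /or3P[] /eqP->.
- by rewrite normrN1.
- by rewrite normr0.
- by rewrite normr1.
Qed.

Lemma classB_ternary f : classB f -> ternary f.
Proof. by move=> [a0 ha] [|n]; [rewrite a0 !inE eqxx !orbT|exact: ha]. Qed.

Lemma unit_bounded_tail n f : unit_bounded f -> unit_bounded (tail n f).
Proof. by move=> ha k; exact: ha. Qed.

(** An estimate that reproduces itself along the tails of a series with a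
    factor [q < 1] can be iterated; the a priori bound [B] kills the
    remainder. *)
Lemma contraction_le (G : R^nat) q c B : 0 <= q < 1 ->
  (forall n, G n <= B) -> (forall n, G n <= c + q * G n.+1) ->
  G 0%N <= c / (1 - q).
Proof.
move=> /andP[q0 q1] GB Gq; pose L := c / (1 - q).
have q1' : 0 < 1 - q by rewrite subr_gt0.
have LE : L = c + q * L.
  by rewrite /L; field; rewrite gt_eqF.
have step n : G 0%N - L <= `|B - L| * q ^+ n.
  have : G 0%N - L <= q ^+ n * (G n - L).
    elim: n => [|n IH]; first by rewrite expr0 mul1r.
    apply: le_trans IH _; rewrite exprSr -mulrA.
    apply: ler_wpM2l; first exact: exprn_ge0.
    by have := Gq n; lra.
  move=> /le_trans; apply; rewrite mulrC ler_wpM2r ?exprn_ge0//.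
  by apply: le_trans (ler_norm _); rewrite lerB.
rewrite -subr_le0 -/L.
have q1n : `|q| < 1 by rewrite ger0_norm.
have cv : geometric `|B - L| q @ \oo --> 0 by exact: cvg_geometric.
rewrite -(cvg_lim (@Rhausdorff R) cv); apply: limr_ge; first exact: cvgP cv.
by apply: nearW => n; exact: step.
Qed.

Lemma is_cvg_psum f x : unit_bounded f -> `|x| < 1 -> cvgn (pseries f x).
Proof.
move=> ha hx; apply: normed_cvg.
apply: (@series_le_cvg _ _ (geometric 1 `|x|)) => [n|n|n|] /=.
- exact: normr_ge0.
- by rewrite mul1r exprn_ge0.
- rewrite normrM normrX ler_wpM2r ?exprn_ge0//; exact: ha.
- by apply: is_cvg_geometric_series; rewrite normr_id.
Qed.

Lemma psum_norm_le f x : unit_bounded f -> `|x| < 1 ->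
  `|psum f x| <= (1 - `|x|)^-1.
Proof.
move=> ha hx; have cv := is_cvg_psum _ _ ha hx.
rewrite /psum -lim_norm//.
have x1 : 0 < 1 - `|x| by rewrite subr_gt0.
apply: limr_le; first exact: is_cvg_norm.
apply: nearW => n; rewrite /pseries /series /=.
apply: le_trans (ler_norm_sum _ _ _) _.
have : \sum_(0 <= k < n) `|f k * x ^+ k| <= \sum_(0 <= k < n) `|x| ^+ k.
  apply: ler_sum => k _; rewrite normrM normrX ler_piMl ?exprn_ge0//; exact: ha.
move=> /le_trans; apply.
have -> : \sum_(0 <= k < n) `|x| ^+ k = series (geometric 1 `|x|) n.
  by rewrite /series /=; apply: eq_bigr => k _; rewrite mul1r.
rewrite geometric_seriesE ?lt_eqF//= mul1r ler_piMl ?invr_ge0 ?(ltW x1)// gerBl exprn_ge0.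
Qed.

Lemma psumB f g x : unit_bounded f -> unit_bounded g -> `|x| < 1 ->
  psum (fun n => f n - g n) x = psum f x - psum g x.
Proof.
move=> ha hb hx; rewrite /psum -limB; [|exact: is_cvg_psum..].
congr (lim (_ @ \oo)); apply/funext => n /=.
rewrite /pseries /series /= -[RHS]sumrB; apply: eq_bigr => i _.
by rewrite mulrBl.
Qed.

Lemma psum_recl f x : unit_bounded f -> `|x| < 1 ->
  psum f x = f 0%N + x * psum (tail 1 f) x.
Proof.
move=> ha hx; apply: cvg_lim => //.
rewrite -cvg_shiftS.
have -> : (fun n => pseries f x n.+1) =
          (fun n => f 0%N + x * pseries (tail 1 f) x n).
  apply/funext => n; rewrite /pseries /series /= big_nat_recl//= expr0 mulr1.
  congr (_ + _); rewrite mulr_sumr; apply: eq_bigr => i _.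
  by rewrite /tail add1n exprS mulrCA.
apply: cvgD; first exact: cvg_cst.
apply: cvgM; first exact: cvg_cst.
apply: is_cvg_psum => //; exact: unit_bounded_tail.
Qed.

Lemma tail_tail1 n f : tail 1 (tail n f) = tail n.+1 f.
Proof. by apply/funext => k; rewrite /tail add1n addnS. Qed.

Lemma psum_tail n f x : unit_bounded f -> `|x| < 1 ->
  psum (tail n f) x = f n + x * psum (tail n.+1 f) x.
Proof.
move=> hf hx; rewrite psum_recl//; last exact: unit_bounded_tail.
by rewrite tail_tail1 {1}/tail addn0.
Qed.

Lemma truncp0 f x : (truncp f 0).[x] = f 0%N.
Proof. by rewrite /truncp horner_poly big_ord1 expr0 mulr1. Qed.

Lemma truncpS f n x : (truncp f n.+1).[x] = (truncp f n).[x] + f n.+1 * x ^+ n.+1.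
Proof. by rewrite /truncp !horner_poly big_ord_recr. Qed.

Lemma psum_truncp f n x : unit_bounded f -> `|x| < 1 ->
  psum f x = (truncp f n).[x] + x ^+ n.+1 * psum (tail n.+1 f) x.
Proof.
move=> ha hx; elim: n => [|n ->]; first by rewrite truncp0 expr1; exact: psum_recl.
rewrite truncpS psum_tail//.
by rewrite [x ^+ n.+2]exprSr; ring.
Qed.

(** The difference [psum f x - psum f y] is at most a multiple of [x - y] plus
    [y] times the same difference for the tail of [f], so [contraction_le]
    applies.  The constant does not depend on [f]. *)
Lemma psum_lipschitz f x y : unit_bounded f -> `|x| < 1 -> `|y| < 1 ->
  `|psum f x - psum f y| <= `|x - y| / (1 - `|x|) / (1 - `|y|).
Proof.
move=> ha hx hy.
pose G n := `|psum (tail n f) x - psum (tail n f) y|.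
have -> : `|psum f x - psum f y| = G 0%N by [].
apply: (contraction_le _ _ _ ((1 - `|x|)^-1 + (1 - `|y|)^-1)).
- by rewrite normr_ge0.
- move=> n; apply: le_trans (ler_normB _ _) _.
  by apply: lerD; apply: psum_norm_le => //; exact: unit_bounded_tail.
move=> n; rewrite /G.
rewrite (psum_tail n _ x)// (psum_tail n _ y)//.
set u := psum _ x; set v := psum _ y.
have -> : f n + x * u - (f n + y * v) = (x - y) * u + y * (u - v) by ring.
apply: le_trans (ler_normD _ _) _; rewrite !normrM lerD2r.
by rewrite ler_wpM2l//; apply: psum_norm_le => //; exact: unit_bounded_tail.
Qed.

Lemma psum_lipschitz_le f x y q r : unit_bounded f -> q < 1 ->
  `|x| <= q -> `|y| <= q -> `|x - y| <= r ->
  `|psum f x - psum f y| <= r / (1 - q) / (1 - q).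
Proof.
move=> hf q1 hx hy xy.
have inv_le c : c <= q -> 0 <= (1 - c)^-1 <= (1 - q)^-1.
  move=> cq; rewrite invr_ge0 subr_ge0 (le_trans cq) ?(ltW q1)//=.
  by rewrite lef_pV2 ?posrE ?subr_gt0 ?(le_lt_trans cq)// lerB.
apply: le_trans (psum_lipschitz _ _ _ hf _ _) _; try exact: le_lt_trans q1.
have /andP[? ?] := inv_le _ hx; have /andP[? ?] := inv_le _ hy.
by apply: ler_pM => //; [exact: mulr_ge0|exact: ler_pM].
Qed.

(** * Expansions with digits -1, 0, 1 *)
Definition lcons (c : R) f : R^nat := fun n => if n is k.+1 then f k else c.

Lemma tail_lcons c f : tail 1 (lcons c f) = f.
Proof. by apply/funext => k; rewrite /tail add1n. Qed.

(** The hypothesis on [K] is that the maps [p |-> (d + x p.1, d + y p.2)], for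
    the three digits [d], send [K] onto a superset of [K].  Choosing a digit at
    each step produces the coefficients of [h], and the remainders tend to 0
    since [K] is bounded. *)
Lemma self_covering_expansion (K : set (R * R)) x y B :
  x != 0 -> y != 0 -> `|x| < 1 -> `|y| < 1 ->
  (forall p, K p -> `|p.1| <= B /\ `|p.2| <= B) ->
  (forall p, K p -> exists d, d \in [:: -1; 0; 1] /\
     K ((p.1 - d) / x, (p.2 - d) / y)) ->
  forall p, K p -> exists h, [/\ ternary h, psum h x = p.1 & psum h y = p.2].
Proof.
move=> x0 y0 hx hy KB Kstep p Kp.
have [f fP] : exists f : R * R -> R, forall p, f p \in [:: -1; 0; 1] /\
    (K p -> K ((p.1 - f p) / x, (p.2 - f p) / y)).
  suff /boolp.choice[f fP] : forall p, exists d : R, d \in [:: -1; 0; 1] /\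
    (K p -> K ((p.1 - d) / x, (p.2 - d) / y)) by exists f.
  move=> r.
  have [Kr|nKr] := pselect (K r); last by exists 0; rewrite !inE eqxx !orbT.
  by have [d [dP Kd]] := Kstep _ Kr; exists d.
pose T r := ((r.1 - f r) / x, (r.2 - f r) / y).
pose P n := iter n T p.
have KP n : K (P n) by elim: n => // n IH; exact: (fP _).2 IH.
pose h : R^nat := fun n => f (P n).
have hh : ternary h by move=> n; exact: (fP _).1.
have hb := ternary_unit_bounded h hh.
have key (z : R) (c : R * R -> R) : z != 0 -> `|z| < 1 ->
    (forall r, K r -> `|c r| <= B) ->
    (forall r, c (T r) = (c r - f r) / z) -> psum h z = c p.
  move=> z0 hz cB cT; apply/eqP; rewrite -subr_eq0 -normr_le0.
  pose G n := `|psum (tail n h) z - c (P n)|.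
  rewrite (_ : psum h z - c p = psum (tail 0 h) z - c (P 0%N))//.
  rewrite -(mul0r (1 - `|z|)^-1).
  apply: (contraction_le G _ _ ((1 - `|z|)^-1 + B)).
  - by rewrite normr_ge0.
  - move=> n; apply: le_trans (ler_normB _ _) _; apply: lerD; last exact: cB.
    by apply: psum_norm_le => //; exact: unit_bounded_tail.
  move=> n; rewrite add0r /G psum_tail//.
  rewrite [P n.+1]/= cT /h -normrM.
  rewrite (_ : _ - c (P n) = z * (psum (fun k => f (P (n.+1 + k)%N)) z
     - (c (P n) - f (P n)) / z))//.
  by field.
exists h; split=> //.
- by apply: (key x fst) => // r /KB[].
- by apply: (key y snd) => // r /KB[].
Qed.

(** Equivalently, the two pieces of the attractor of
    [p |-> (x p.1, y p.2)] and [p |-> (1 + x p.1, 1 + y p.2)] are within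
    distance [e] of each other in the maximum norm. *)
Definition near_zero x y e :=
  exists f, [/\ classB f, `|psum f x| <= e & `|psum f y| <= e].

Lemma near_zeroW x y e e' : e <= e' -> near_zero x y e -> near_zero x y e'.
Proof.
by move=> le [f [aB ax ay]]; exists f; split=> //; exact: le_trans le.
Qed.

(** Compactness of the set of digit sequences.  The pairs that are
    approximated arbitrarily well by values of ternary series form a bounded
    self-covering set: if each of the three digits failed as a first digit at
    some precision, none would be possible at the smallest of these
    precisions. *)
Lemma near_zero_setN x y : x != 0 -> y != 0 -> `|x| < 1 -> `|y| < 1 ->
  (forall e, 0 < e -> near_zero x y e) -> setN R (x, y).
Proof.
move=> x0 y0 hx hy nz.
pose K : set (R * R) := [set p | forall e, 0 < e -> exists h,
  [/\ ternary h, `|psum h x - p.1| <= e & `|psum h y - p.2| <= e]].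
pose B := Num.max (1 - `|x|)^-1 (1 - `|y|)^-1 + 1.
have KB p : K p -> `|p.1| <= B /\ `|p.2| <= B.
  move=> /(_ 1 ltr01)[h [/ternary_unit_bounded hb hp1 hp2]].
  have main (z c : R) : `|z| < 1 -> `|psum h z - c| <= 1 ->
      `|c| <= (1 - `|z|)^-1 + 1.
    move=> hz hc; rewrite -[c](subKr (psum h z)).
    apply: le_trans (ler_normB _ _) _; apply: lerD => //.
    exact: psum_norm_le.
  by split; [apply: le_trans (main _ _ hx hp1) _|apply: le_trans (main _ _ hy hp2) _];
    rewrite lerD2r le_max lexx ?orbT.
have shift (z e c : R) h : z != 0 -> `|z| < 1 -> ternary h ->
    `|psum h z - c| <= e * `|z| -> `|psum (tail 1 h) z - (c - h 0%N) / z| <= e.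
  move=> z0 hz /ternary_unit_bounded hh; rewrite psum_recl//.
  rewrite (_ : _ - c = z * (psum (tail 1 h) z - (c - h 0%N) / z)).
    by rewrite normrM mulrC ler_pM2r// normr_gt0.
  by field.
have Kstep p : K p -> exists d, d \in [:: -1; 0; 1] /\
    K ((p.1 - d) / x, (p.2 - d) / y).
  move=> Kp; apply/not_existsP => nK.
  have fail d : exists e, 0 < e /\ (d \in [:: -1; 0; 1] -> forall h, ternary h ->
      `|psum h x - (p.1 - d) / x| <= e -> `|psum h y - (p.2 - d) / y| <= e -> False).
    have [dP|dP] := pselect (d \in [:: -1; 0; 1] : Prop); last by exists 1.
    have nKd : ~ K ((p.1 - d) / x, (p.2 - d) / y) by move=> Kd; exact: (nK d).
    have /existsNP[e /not_implyP[e0 ne]] := nKd.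
    by exists e; split=> // _ h ht hx1 hy1; apply: ne; exists h.
  have [e1 [e10 f1]] := fail (-1); have [e2 [e20 f2]] := fail 0.
  have [e3 [e30 f3]] := fail 1.
  pose e := Num.min e1 (Num.min e2 e3).
  have e0 : 0 < e by rewrite !lt_min e10 e20.
  have ee1 : e <= e1 by rewrite ge_min lexx.
  have ee2 : e <= e2 by rewrite !ge_min lexx orbT.
  have ee3 : e <= e3 by rewrite !ge_min lexx !orbT.
  pose m := Num.min `|x| `|y|.
  have m0 : 0 < m by rewrite lt_min !normr_gt0 x0.
  have [h [hh hp1 hp2]] := Kp (e * m) (mulr_gt0 e0 m0).
  have {}hp1 : `|psum h x - p.1| <= e * `|x|.
    by apply: le_trans hp1 _; rewrite ler_pM2l// ge_min lexx.
  have {}hp2 : `|psum h y - p.2| <= e * `|y|.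
    by apply: le_trans hp2 _; rewrite ler_pM2l// ge_min lexx orbT.
  have t1 := shift _ _ _ _ x0 hx hh hp1; have t2 := shift _ _ _ _ y0 hy hh hp2.
  have ht : ternary (tail 1 h) by move=> k; exact: hh.
  have := hh 0%N; rewrite !inE => /or3P[] /eqP h0; rewrite h0 in t1 t2.
  - by apply: (f1 _ _ ht (le_trans t1 ee1) (le_trans t2 ee1)); rewrite !inE eqxx.
  - by apply: (f2 _ _ ht (le_trans t1 ee2) (le_trans t2 ee2)); rewrite !inE eqxx orbT.
  - by apply: (f3 _ _ ht (le_trans t1 ee3) (le_trans t2 ee3)); rewrite !inE eqxx !orbT.
have K0 : K (- x^-1, - y^-1).
  move=> e e0; pose m := Num.min `|x| `|y|.
  have m0 : 0 < m by rewrite lt_min !normr_gt0 x0.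
  have [f [aB ax ay]] := nz (e * m) (mulr_gt0 e0 m0).
  exists (tail 1 f); split => /=.
  - by move=> k; exact: (classB_ternary f aB (1 + k)%N).
  - rewrite -[- x^-1]mulN1r -[-1]sub0r -aB.1; apply: shift => //.
      exact: classB_ternary.
    by rewrite subr0; apply: le_trans ax _; rewrite ler_pM2l// ge_min lexx.
  - rewrite -[- y^-1]mulN1r -[-1]sub0r -aB.1; apply: shift => //.
      exact: classB_ternary.
    by rewrite subr0; apply: le_trans ay _; rewrite ler_pM2l// ge_min lexx orbT.
have [h [hh hx1 hy1]] := self_covering_expansion K x y B x0 y0 hx hy KB Kstep _ K0.
have aB : classB (lcons 1 h) by split=> //; exact: hh.
have aub := ternary_unit_bounded _ (classB_ternary _ aB).
split=> /=; first by split; rewrite /= in_itv/= -ltr_norml.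
exists (lcons 1 h); split=> //.
- by rewrite psum_recl// tail_lcons hx1 /= mulrN mulfV// subrr.
- by rewrite psum_recl// tail_lcons hy1 /= mulrN mulfV// subrr.
Qed.

Lemma setN_of_halving x y e0 : x != 0 -> y != 0 -> `|x| < 1 -> `|y| < 1 ->
  near_zero x y e0 ->
  (forall e, 0 < e <= e0 -> near_zero x y e -> near_zero x y (e / 2)) ->
  setN R (x, y).
Proof.
move=> x0 y0 hx hy nz0 half; apply: near_zero_setN => // e egt0.
have [e0gt0|e0le0] := ltP 0 e0; last first.
  by apply: near_zeroW nz0; rewrite (le_trans e0le0)// ltW.
have nzn n : near_zero x y (geometric e0 2^-1 n).
  elim: n => [|n IH] /=; first by rewrite expr0 mulr1.
  rewrite exprSr mulrA; apply: half => //.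
  by rewrite mulr_gt0 ?exprn_gt0//= ler_piMr ?exprn_ile1 ?(ltW e0gt0)// invf_le1 ?ler1n.
have cv : geometric e0 2^-1 @ \oo --> (0 : R).
  by apply: cvg_geometric; rewrite gtr0_norm// invf_lt1// ltr1n.
have : \forall n \near \oo, geometric e0 2^-1 n < e by exact: (cvgr_lt _ cv).
by case=> n _ /(_ n (leqnn n)) /ltW lt; exact: near_zeroW lt (nzn n).
Qed.

(** * Chains in the attractor *)
Definition bits a : R^nat := fun n => (a n)%:R.

Definition bcons (d : bool) a : nat -> bool := fun n => if n is k.+1 then a k else d.

Lemma unit_bounded_bits a : unit_bounded (bits a).
Proof. by move=> n; rewrite /bits; case: (a n); rewrite ?normr1 ?normr0. Qed.

Lemma psum_bcons d a x : `|x| < 1 ->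
  psum (bits (bcons d a)) x = d%:R + x * psum (bits a) x.
Proof.
by move=> hx; rewrite psum_recl//; exact: unit_bounded_bits.
Qed.

Lemma ternary_bitsB a b : ternary (fun n => bits a n - bits b n).
Proof.
move=> n; rewrite /bits; case: (a n); case: (b n);
  by rewrite /= ?subr0 ?sub0r ?subrr !inE eqxx ?orbT.
Qed.

Lemma bcons_eta a : bcons (a 0%N) (fun n => a n.+1) = a.
Proof. by apply/funext => -[]. Qed.

(** The positive and the negative coefficients of a class B series form two 0-1
    sequences, with first digits 1 and 0: an approximate zero is the same as an
    approximate coincidence of points in the two pieces of the attractor. *)
Lemma classB_bits (f : R^nat) : classB f -> exists a b,
  [/\ a 0%N, ~~ b 0%N & f = (fun n => bits a n - bits b n)].
Proof.
move=> fB; exists (fun n => f n == 1), (fun n => f n == -1).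
rewrite fB.1; split; first by rewrite eqxx.
  by rewrite -subr_eq0 opprK (_ : 1 + 1 = 2%:R)// pnatr_eq0.
have n1 : (-1 == 1 :> R) = false by apply/negbTE/eqP; lra.
have n2 : (1 == -1 :> R) = false by apply/negbTE/eqP; lra.
have n3 : (0 == 1 :> R) = false by apply/negbTE/eqP; lra.
have n4 : (0 == -1 :> R) = false by apply/negbTE/eqP; lra.
apply/funext => n; rewrite /bits.
have := classB_ternary f fB n; rewrite !inE => /or3P[] /eqP->;
  by rewrite ?eqxx ?n1 ?n2 ?n3 ?n4 /= ?subr0 ?sub0r.
Qed.

Definition close x y e a b :=
  (`|psum (bits a) x - psum (bits b) x| <= e) &&
  (`|psum (bits a) y - psum (bits b) y| <= e).

Lemma close_sym x y e a b : close x y e a b = close x y e b a.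
Proof. by congr (_ && _); rewrite distrC. Qed.

Definition linked x y e a b :=
  exists2 s, path (close x y e) a s & last a s = b.

Lemma linked_trans x y e a b c :
  linked x y e a b -> linked x y e b c -> linked x y e a c.
Proof.
move=> [s ps ls] [t pt lt]; exists (s ++ t); last by rewrite last_cat ls.
by rewrite cat_path ps ls.
Qed.

Lemma close_linked x y e a b : close x y e a b -> linked x y e a b.
Proof. by move=> h; exists [:: b] => //=; rewrite h. Qed.

Lemma linked_bcons x y q e e' d a b : `|x| < 1 -> `|y| < 1 ->
  `|x| <= q -> `|y| <= q -> q * e <= e' ->
  linked x y e a b -> linked x y e' (bcons d a) (bcons d b).
Proof.
move=> hx hy hxq hyq qe [s ps ls]; exists (map (bcons d) s); last first.
  by rewrite last_map ls.
rewrite path_map; apply: sub_path ps => u v /andP[uvx uvy].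
have main z : `|z| < 1 -> `|z| <= q -> `|psum (bits u) z - psum (bits v) z| <= e ->
   `|psum (bits (bcons d u)) z - psum (bits (bcons d v)) z| <= e'.
  move=> hz hzq huv; rewrite !psum_bcons//.
  rewrite (_ : _ - _ = z * (psum (bits u) z - psum (bits v) z)); last by ring.
  by rewrite normrM; apply: le_trans qe; apply: ler_pM.
by apply/andP; split; exact: main.
Qed.

(** Suppose that any two points can be linked with steps at most [E].
    Prepending a common digit contracts the steps by [q]; this links points
    with the same first digit, and the near-coincidence of the two pieces
    bridges the remaining case with one step of size [e].  So [E] may be
    replaced by the maximum of [q E] and [e]. *)
Lemma near_zero_linked x y e a b : 0 < e -> `|x| < 1 -> `|y| < 1 ->
  near_zero x y e -> linked x y e a b.
Proof.
move=> e0 hx hy [f [fB fx fy]].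
have [al [be [al0 be0 fE]]] := classB_bits f fB.
have albe : close x y e al be.
  rewrite /close -!psumB -?fE ?fx//; exact: unit_bounded_bits.
pose q := Num.max `|x| `|y|.
have hxq : `|x| <= q by rewrite le_max lexx.
have hyq : `|y| <= q by rewrite le_max lexx orbT.
have q0 : 0 <= q by exact: le_trans hxq.
have q1 : q < 1 by rewrite gt_max hx.
(* An upper bound for the diameter of the attractor. *)
pose E := 2 / (1 - q).
have q1' : 0 < 1 - q by rewrite subr_gt0.
have base u v : linked x y E u v.
  apply: close_linked.
  have main z : `|z| < 1 -> `|z| <= q ->
      `|psum (bits u) z - psum (bits v) z| <= E.
    move=> hz hzq; apply: le_trans (ler_normB _ _) _.
    have bd w : `|psum (bits w) z| <= (1 - q)^-1.
      apply: le_trans (psum_norm_le _ _ (unit_bounded_bits w) hz) _.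
      by rewrite lef_pV2 ?posrE// ?subr_gt0// lerB.
    by rewrite /E; have := bd u; have := bd v; lra.
  by rewrite /close !main.
have all_linked n u v : linked x y (Num.max (geometric E q n) e) u v.
  elim: n u v => [|n IH] u v /=.
    have [s ps ls] := base u v; exists s => //.
    apply: sub_path ps => c d /andP[h1 h2].
    by rewrite /close !le_max expr0 mulr1 h1 h2.
  set e' := Num.max _ e.
  have same d u' v' : linked x y e' (bcons d u') (bcons d v').
    apply: (linked_bcons _ _ q) (IH u' v') => //=.
    rewrite maxr_pMr// ge_max mulrCA -exprS; apply/andP; split.
      by rewrite le_max lexx.
    by rewrite le_max; apply/orP; right; rewrite ler_piMl ?ltW.
  have same' c c' : c 0%N = c' 0%N -> linked x y e' c c'.
    by move=> cc'; rewrite -(bcons_eta c) -(bcons_eta c') cc'.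
  have albe' : close x y e' al be.
    by move: albe => /andP[h1 h2]; rewrite /close !le_max h1 h2 !orbT.
  case u0 : (u 0%N); case v0 : (v 0%N).
  - by apply: same'; rewrite u0 v0.
  - apply: (linked_trans _ _ _ _ al); first by apply: same'; rewrite u0 al0.
    apply: (linked_trans _ _ _ _ be); first exact: close_linked.
    by apply: same'; rewrite v0 (negbTE be0).
  - apply: (linked_trans _ _ _ _ be); first by apply: same'; rewrite u0 (negbTE be0).
    apply: (linked_trans _ _ _ _ al); first by apply: close_linked; rewrite close_sym.
    by apply: same'; rewrite v0 al0.
  - by apply: same'; rewrite u0 v0.
have cv : geometric E q @ \oo --> (0 : R).
  by apply: cvg_geometric; rewrite ger0_norm.
have : \forall n \near \oo, geometric E q n < e by exact: (cvgr_lt _ cv).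
case=> n _ /(_ n (leqnn n)) /ltW lt.
by have := all_linked n a b; rewrite max_r.
Qed.

(** * A discrete crossing argument in the plane *)

(** Discrete Stokes formula: if an edge cochain ([h] on horizontal edges, [v]
    on vertical ones) has zero circulation around every unit square, then it
    has zero circulation around the whole rectangle. *)
Lemma grid_stokes (k m : nat) (h v : nat -> nat -> int) :
  (forall i j, (i < k)%N -> (j < m)%N ->
     h i j + v i.+1 j - h i j.+1 - v i j = 0) ->
  \sum_(i < k) h i 0%N + \sum_(j < m) v k j
    - \sum_(i < k) h i m - \sum_(j < m) v 0%N j = 0.
Proof.
move=> sq.
have: \sum_(i < k) \sum_(j < m) (h i j + v i.+1 j - h i j.+1 - v i j) = 0.
  by apply: big1 => i _; apply: big1 => j _; exact: sq.
have rowE (i : nat) : \sum_(j < m) (h i j + v i.+1 j - h i j.+1 - v i j) =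
   (h i 0%N - h i m) + (\sum_(j < m) v i.+1 j - \sum_(j < m) v i j).
  elim: m {sq} => [|m IH]; first by rewrite !big_ord0 subrr addr0.
  by rewrite !big_ord_recr/= IH; ring.
under eq_bigr do rewrite rowE.
rewrite big_split/= sumrB.
have -> : \sum_(i < k) (\sum_(j < m) v i.+1 j - \sum_(j < m) v i j) =
   \sum_(j < m) v k j - \sum_(j < m) v 0%N j.
  rewrite -(big_mkord xpredT
    (fun i => \sum_(j < m) v i.+1 j - \sum_(j < m) v i j)).
  by rewrite telescope_sumr.
move=> eq0; rewrite -[RHS]eq0; ring.
Qed.

(** Signed number of crossings of the negative vertical half-axis, from left to
    right, by the segment from [p] to [q].  The sum over a closed polygon is its
    winding number if the edges are short compared to the distance from the
    origin. *)
Definition lower_jump (p q : R * R) : int :=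
  if (p.2 <= 0) && (q.2 <= 0) then (0 <= q.1)%R%:R - (0 <= p.1)%R%:R else 0.

(** The jumps around a square cancel unless its vertices visit the lower left
    quadrant, the right half-plane and the upper half-plane.  When the square
    is small, this only happens near the origin. *)
Lemma square_jump (A B C D : R * R) :
  lower_jump A B + lower_jump B C - lower_jump D C - lower_jump A D != 0 ->
  exists p q r : R * R, [/\ p \in [:: A; B; C; D], q \in [:: A; B; C; D],
    r \in [:: A; B; C; D] & [/\ p.2 <= 0 /\ p.1 < 0, 0 <= q.1 & 0 < r.2]].
Proof.
move=> jump; pose S := [:: A; B; C; D].
have [|/allPn[r rS]] := boolP (all (fun p => p.2 <= 0) S).
  move=> /and5P[A2 B2 C2 D2 _]; case/eqP: jump.
  by rewrite /lower_jump A2 B2 C2 D2 /=; ring.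
rewrite -ltNge => r2.
have [|/allPn[p pS]] := boolP (all (fun p => (p.2 <= 0) ==> (0 <= p.1)) S).
  have jump0 (p q : R * R) : (p.2 <= 0) ==> (0 <= p.1) -> (q.2 <= 0) ==> (0 <= q.1) ->
      lower_jump p q = 0.
    move=> /implyP hp /implyP hq; rewrite /lower_jump.
    by case: ifPn => // /andP[/hp -> /hq ->]; rewrite subrr.
  move=> /and5P[hA hB hC hD _]; case/eqP: jump.
  by rewrite !jump0.
rewrite negb_imply -ltNge => /andP[p2 p1].
have [|/allPn[q qS]] := boolP (all (fun p => p.1 < 0) S).
  have jump0 (u v : R * R) : u.1 < 0 -> v.1 < 0 -> lower_jump u v = 0.
    move=> u1 v1; rewrite /lower_jump !leNgt u1 v1 /=.
    by rewrite subrr; case: ifP.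
  move=> /and5P[hA hB hC hD _]; case/eqP: jump.
  by rewrite !jump0.
rewrite -leNgt => q1.
by exists p, q, r.
Qed.

Lemma square_diameter (a b c d e s t : R) :
  `|b - a| <= e -> `|c - b| <= e -> `|c - d| <= e -> `|d - a| <= e ->
  s \in [:: a; b; c; d] -> t \in [:: a; b; c; d] -> s <= t + 2 * e.
Proof.
move=> /ler_normlP[? ?] /ler_normlP[? ?] /ler_normlP[? ?] /ler_normlP[? ?].
by rewrite !inE => /or4P[] /eqP-> /or4P[] /eqP->; lra.
Qed.

(** The assumptions on the sides make the circulation around the boundary of
    the rectangle equal to 1: the bottom side goes from left to right below
    the origin, the top side starts and ends on the left and also passes below
    the origin, and the two vertical sides cross the vertical axis only above
    the origin.  By the Stokes
    formula some small square has a nonzero circulation. *)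
Lemma grid_crossing (k m : nat) (f : nat -> nat -> R * R) (e : R) :
  (forall i j, (i < k)%N -> (j <= m)%N ->
     `|(f i.+1 j).1 - (f i j).1| <= e /\ `|(f i.+1 j).2 - (f i j).2| <= e) ->
  (forall i j, (i <= k)%N -> (j < m)%N ->
     `|(f i j.+1).1 - (f i j).1| <= e /\ `|(f i j.+1).2 - (f i j).2| <= e) ->
  (forall i, (i <= k)%N -> `|(f i 0%N).1| <= e -> (f i 0%N).2 <= 0) ->
  (forall i, (i <= k)%N -> `|(f i m).1| <= e -> (f i m).2 <= 0) ->
  (forall j, (j <= m)%N -> `|(f 0%N j).1| <= e -> 0 < (f 0%N j).2) ->
  (forall j, (j <= m)%N -> `|(f k j).1| <= e -> 0 < (f k j).2) ->
  (f 0%N 0%N).1 < 0 -> 0 <= (f k 0%N).1 -> (f 0%N m).1 < 0 -> (f k m).1 < 0 ->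
  exists i j, [/\ (i <= k)%N, (j <= m)%N, `|(f i j).1| <= 2 * e & `|(f i j).2| <= 2 * e].
Proof.
move=> hH hV bot top left right c00 ck0 c0m ckm.
apply: contrapT => none.
pose h i j := lower_jump (f i j) (f i.+1 j).
pose v i j := lower_jump (f i j) (f i j.+1).
have sq i j : (i < k)%N -> (j < m)%N -> h i j + v i.+1 j - h i j.+1 - v i j = 0.
  move=> ik jm; apply/eqP; apply: contrapT => /negP /square_jump.
  move=> [p [q [r [pin qin rin [[p2 p1] q1 r2]]]]].
  have diam s t : s \in [:: f i j; f i.+1 j; f i.+1 j.+1; f i j.+1] ->
      t \in [:: f i j; f i.+1 j; f i.+1 j.+1; f i j.+1] ->
      s.1 <= t.1 + 2 * e /\ s.2 <= t.2 + 2 * e.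
    have [? ?] := hH i j ik (ltnW jm); have [? ?] := hH i j.+1 ik jm.
    have [? ?] := hV i j (ltnW ik) jm; have [? ?] := hV i.+1 j ik jm.
    move=> sS tS; split.
      by apply: square_diameter (map_f fst sS) (map_f fst tS).
    by apply: square_diameter (map_f snd sS) (map_f snd tS).
  have [i' [j' [ik' jm' pE]]] : exists i' j', [/\ (i' <= k)%N, (j' <= m)%N & p = f i' j'].
    move: pin; rewrite !inE => /or4P[] /eqP->.
    - by exists i, j; rewrite (ltnW ik) (ltnW jm).
    - by exists i.+1, j; rewrite ik (ltnW jm).
    - by exists i.+1, j.+1; rewrite ik jm.
    - by exists i, j.+1; rewrite (ltnW ik) jm.
  apply: none; exists i', j'; rewrite -pE; split=> //.
    by have [] := diam _ _ qin pin; rewrite ler0_norm; lra.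
  by have [] := diam _ _ rin pin; rewrite ler0_norm; lra.
have jump_lower (p q : R * R) : (`|p.1| <= e -> p.2 <= 0) -> (`|q.1| <= e -> q.2 <= 0) ->
    `|q.1 - p.1| <= e ->
    lower_jump p q = (0 <= q.1)%R%:R - (0 <= p.1)%R%:R.
  move=> hp hq; rewrite ler_norml => /andP[pq1 pq2]; rewrite /lower_jump.
  case: ifPn => // /nandP nl.
  suff -> : (0 <= q.1) = (0 <= p.1) by rewrite subrr.
  apply/idP/idP => h0; rewrite leNgt; apply/negP => h1; case: nl => /negP; apply;
    by [apply: hp; rewrite ler_norml; apply/andP; split; lra
       |apply: hq; rewrite ler_norml; apply/andP; split; lra].
have jump_upper (p q : R * R) : (`|p.1| <= e -> 0 < p.2) -> (`|q.1| <= e -> 0 < q.2) ->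
    `|q.1 - p.1| <= e -> lower_jump p q = 0.
  move=> hp hq; rewrite ler_norml => /andP[pq1 pq2]; rewrite /lower_jump.
  case: ifPn => // /andP[p2 q2].
  have np : ~ `|p.1| <= e by move=> /hp; lra.
  have nq : ~ `|q.1| <= e by move=> /hq; lra.
  suff -> : (0 <= q.1) = (0 <= p.1) by rewrite subrr.
  apply/idP/idP => h0; rewrite leNgt; apply/negP => h1; apply: np;
    by rewrite ler_norml; apply/andP; split; lra.
have := grid_stokes k m h v sq.
have tel (g : nat -> int) n : \sum_(i < n) (g i.+1 - g i) = g n - g 0%N.
  by rewrite -(big_mkord xpredT (fun i => g i.+1 - g i)) telescope_sumr.
have -> : \sum_(i < k) h i 0%N = 1.
  rewrite (eq_bigr (fun i : 'I_k => (0 <= (f i.+1 0%N).1)%R%:R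
      - (0 <= (f i 0%N).1)%R%:R)); last first.
    move=> i _; apply: jump_lower; [apply: bot; exact: ltnW|exact: bot|].
    by case: (hH i 0%N (ltn_ord i) (leq0n _)).
  by rewrite (tel (fun i => (0 <= (f i 0%N).1)%R%:R)) ck0 leNgt c00.
have -> : \sum_(i < k) h i m = 0.
  rewrite (eq_bigr (fun i : 'I_k => (0 <= (f i.+1 m).1)%R%:R
      - (0 <= (f i m).1)%R%:R)); last first.
    move=> i _; apply: jump_lower; [apply: top; exact: ltnW|exact: top|].
    by case: (hH i m (ltn_ord i) (leqnn _)).
  by rewrite (tel (fun i => (0 <= (f i m).1)%R%:R)) !leNgt c0m ckm.
have -> : \sum_(j < m) v k j = 0.
  apply: big1 => j _; apply: jump_upper; [apply: right; exact: ltnW|exact: right|].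
  by case: (hV k j (leqnn _) (ltn_ord j)).
have -> : \sum_(j < m) v 0%N j = 0.
  apply: big1 => j _; apply: jump_upper; [apply: left; exact: ltnW|exact: left|].
  by case: (hV 0%N j (leq0n _) (ltn_ord j)).
by [].
Qed.

(** The chain [P] runs from a point to its translate by [(1, 0)], and stays
    below this horizontal level except at a horizontal distance of at most
    [1/8] from one of the two ends.  Its translate by
    [w], with [w] close to [(1/2, 0)], starts between the ends of [P] and
    ends beyond them, so it has to cross [P].  The crossing is a
    near-zero of [P i - P j - w] on the grid of pairs [(i, j)]. *)
Lemma chain_meets_translate (k : nat) (P : nat -> R * R) (w : R * R) (e nu : R) :
  e <= 1 / 16 -> `|w.1 - 1 / 2| <= 1 / 16 -> `|w.2| < nu ->
  (forall i, (i < k)%N ->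
     `|(P i.+1).1 - (P i).1| <= e /\ `|(P i.+1).2 - (P i).2| <= e) ->
  (P k).1 = (P 0%N).1 + 1 -> (P k).2 = (P 0%N).2 ->
  (forall i, [\/ `|(P i).1 - (P 0%N).1| <= 1 / 8,
     `|(P i).1 - (P 0%N).1 - 1| <= 1 / 8 | (P i).2 <= (P 0%N).2 - nu]) ->
  exists i j, `|(P i).1 - (P j).1 - w.1| <= 2 * e /\
              `|(P i).2 - (P j).2 - w.2| <= 2 * e.
Proof.
move=> e1 /ler_normlP[wa wb]; rewrite ltr_norml => /andP[wc wd] step Pk1 Pk2 out.
pose f i j := ((P i).1 - (P j).1 - w.1, (P i).2 - (P j).2 - w.2).
suff [i [j [_ _ f1 f2]]] : exists i j, [/\ (i <= k)%N, (j <= k)%N,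
  `|(f i j).1| <= 2 * e & `|(f i j).2| <= 2 * e] by exists i, j.
apply: grid_crossing; rewrite /f /= ?Pk1 ?Pk2.
- move=> i j ik _; have [s1 s2] := step i ik.
  rewrite (_ : _ - _ = (P i.+1).1 - (P i).1); last by ring.
  by rewrite (_ : _ - (_ - _) = (P i.+1).2 - (P i).2); last by ring.
- move=> i j _ jk; have [s1 s2] := step j jk.
  rewrite (_ : _ - _ = (P j).1 - (P j.+1).1); last by ring.
  rewrite (_ : _ - (_ - _) = (P j).2 - (P j.+1).2); last by ring.
  by rewrite distrC [X in _ /\ X <= _]distrC.
- by move=> i _ /ler_normlP[? ?]; have [/ler_normlP[? ?]|/ler_normlP[? ?]|?] := out i; lra.
- by move=> i _ /ler_normlP[? ?]; have [/ler_normlP[? ?]|/ler_normlP[? ?]|?] := out i; lra.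
- by move=> i _ /ler_normlP[? ?]; have [/ler_normlP[? ?]|/ler_normlP[? ?]|?] := out i; lra.
- by move=> i _ /ler_normlP[? ?]; have [/ler_normlP[? ?]|/ler_normlP[? ?]|?] := out i; lra.
- lra.
- lra.
- lra.
- lra.
Qed.

(** * Traps *)

(** Stability of the target [(w1, w2)], see the introduction.  The bound [C e]
    refers to the same [e] that bounds the given class B series; this is what
    makes the bootstrap in [near_zero_half] possible. *)
Definition trap gam lam (w1 w2 : R) := exists rho C e0 : R,
  [/\ 0 < rho, 0 <= C, 0 < e0 & forall x y u v : R,
      `|x| < 1 -> `|y| < 1 ->
      `|x - gam| < rho -> `|y - lam| < rho ->
      `|u - w1| < rho -> `|v - w2| < rho ->
      forall e, 0 < e <= e0 -> near_zero x y e ->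
      exists h, [/\ ternary h, `|psum h x - u| <= C * e &
                    `|psum h y - v| <= C * e]].

Lemma eqr_exp_norm gam lam n : gam ^+ n.+1 = lam ^+ n.+1 -> `|gam| = `|lam|.
Proof.
move=> eq; apply/eqP; rewrite -(@eqrXn2 _ n.+1)//.
by rewrite -!normrX eq.
Qed.

Lemma positive_lower_bound (G : R^nat) K : (forall i, 0 < G i) ->
  exists2 mu, 0 < mu & forall i, (i < K)%N -> mu <= G i.
Proof.
move=> G0; elim: K => [|K [mu mu0 IH]]; first by exists 1.
exists (Num.min mu (G K)); first by rewrite lt_min mu0 G0.
move=> i; rewrite ltnS leq_eqVlt => /orP[/eqP->|iK].
  by rewrite ge_min lexx orbT.
by rewrite ge_min IH.
Qed.

(** A 0-1 sequence that maximizes [height gam lam], with first digit 0.  The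
    first digit does not affect the height, and changing it moves the point of
    the attractor by [(1, 1)]. *)
Definition face gam lam : nat -> bool :=
  fun i => if i is _.+1 then lam ^+ i < gam ^+ i else false.

Definition height x y (a : nat -> bool) := psum (bits a) x - psum (bits a) y.

(** The height is a sum of the numbers [a i * (gam ^+ i - lam ^+ i)], and
    [face] takes exactly those which are positive: every wrong digit costs. *)
Lemma height_drop gam lam (a : nat -> bool) i : `|gam| < 1 -> `|lam| < 1 ->
  a i.+1 != face gam lam i.+1 ->
  height gam lam a <= height gam lam (face gam lam) - `|gam ^+ i.+1 - lam ^+ i.+1|.
Proof.
move=> hg hl ai; set m := face gam lam.
pose b : R^nat := fun n => bits a n - bits m n.
have bb : unit_bounded b.
  by apply: ternary_unit_bounded; exact: ternary_bitsB.
have bE x : `|x| < 1 -> psum b x = psum (bits a) x - psum (bits m) x.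
  by move=> hx; rewrite psumB//; exact: unit_bounded_bits.
suff : psum b gam - psum b lam <= - `|gam ^+ i.+1 - lam ^+ i.+1|.
  by rewrite !bE// /height; lra.
have cg := is_cvg_psum b gam bb hg; have cl := is_cvg_psum b lam bb hl.
rewrite /psum -limB//; apply: limr_le; first exact: is_cvgB.
exists i.+2 => // n /= ni.
have -> : (pseries b gam - pseries b lam) n =
    \sum_(0 <= k < n) (b k * gam ^+ k - b k * lam ^+ k) by rewrite sumrB.
have term k : b k * gam ^+ k - b k * lam ^+ k <= 0.
  case: k => [|k]; first by rewrite !expr0 subrr.
  rewrite /b /bits /m /face -mulrBr; case: ltP => h; case: (a _);
    rewrite /= ?subrr ?mul0r ?sub0r ?subr0 ?mul1r ?mulN1r//; lra.
rewrite (bigD1_seq i.+1) ?iota_uniq ?mem_index_iota//=.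
rewrite -[X in _ <= X]addr0; apply: lerD; last first.
  by apply: sumr_le0 => k _; exact: term.
move: ai; rewrite /b /bits /m /face -mulrBr.
case: ltP => h; case: (a _) => //= _; rewrite ?subr0 ?sub0r ?mul1r ?mulN1r.
  by rewrite gtr0_norm ?subr_gt0.
by rewrite ler0_norm ?subr_le0// opprK.
Qed.

Lemma agree_tail x q K (a m : nat -> bool) : `|x| <= q -> q < 1 ->
  (forall i, (i < K)%N -> a i.+1 = m i.+1) ->
  `|psum (bits a) x - psum (bits m) x - (bits a 0%N - bits m 0%N)|
    <= q ^+ K.+1 / (1 - q).
Proof.
move=> hxq q1 am; have hx : `|x| < 1 by exact: le_lt_trans q1.
pose b : R^nat := fun n => bits a n - bits m n.
have bb : unit_bounded b.
  by apply: ternary_unit_bounded; exact: ternary_bitsB.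
rewrite -psumB//; [|exact: unit_bounded_bits..].
rewrite -/b (psum_truncp b K)//.
have -> : (truncp b K).[x] = b 0%N.
  rewrite /truncp horner_poly big_ord_recl expr0 mulr1 big1 ?addr0// => i _.
  by rewrite /b /bits /= /bump /= add1n am// subrr mul0r.
rewrite addrAC subrr add0r normrM normrX; apply: ler_pM => //.
- by rewrite lerXn2r ?nnegrE// (le_trans _ hxq).
apply: le_trans (psum_norm_le _ _ _ hx) _; first exact: unit_bounded_tail.
by rewrite lef_pV2 ?posrE ?subr_gt0// lerB.
Qed.

Lemma height_lipschitz gam lam x y q rho (a : nat -> bool) : q < 1 ->
  `|x| <= q -> `|gam| <= q -> `|y| <= q -> `|lam| <= q ->
  `|x - gam| <= rho -> `|y - lam| <= rho ->
  `|height x y a - height gam lam a| <= 2 * (rho / (1 - q) / (1 - q)).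
Proof.
move=> q1 hx hg hy hl xg yl.
rewrite /height (_ : _ - _ = (psum (bits a) x - psum (bits a) gam)
  - (psum (bits a) y - psum (bits a) lam)); last by ring.
apply: le_trans (ler_normB _ _) _.
by rewrite mulr2n mulrDl mul1r; apply: lerD;
  exact: psum_lipschitz_le (unit_bounded_bits a) q1 _ _ _.
Qed.

Lemma common_radius gam lam : `|gam| < 1 -> `|lam| < 1 ->
  exists q r, [/\ 0 <= q, q < 1, 0 < r,
    forall z, `|z - gam| < r -> `|z| <= q & forall z, `|z - lam| < r -> `|z| <= q].
Proof.
move=> hg hl; pose Q := Num.max `|gam| `|lam|.
have gQ : `|gam| <= Q by rewrite le_max lexx.
have lQ : `|lam| <= Q by rewrite le_max lexx orbT.
have Q0 : 0 <= Q by exact: le_trans gQ.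
have Q1 : Q < 1 by rewrite gt_max hg.
have close_le z z' : `|z'| <= Q -> `|z - z'| < (1 - Q) / 2 -> `|z| <= (1 + Q) / 2.
  move=> zQ zz'; have := ler_normD (z - z') z'; rewrite subrK.
  by clear -zQ zz'; lra.
exists ((1 + Q) / 2), ((1 - Q) / 2); clear -Q0 Q1 gQ lQ close_le; split.
- lra.
- lra.
- lra.
- by move=> z; exact: close_le.
- by move=> z; exact: close_le.
Qed.

(** A point of the attractor that agrees with [face] on the digits 1 to [K] is
    within [1/8] of one of the two ends, by the size of the tail.  Any other
    point is lower by at least the smallest of the [K] costs, which are
    positive because [gam] and [lam] have different absolute values.
    Heights vary uniformly little with the parameters, and half of this gap
    persists nearby. *)
Lemma face_isolated gam lam : `|gam| < 1 -> `|lam| < 1 ->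
  gam != lam -> gam != - lam ->
  exists rho nu, [/\ 0 < rho, 0 < nu & forall x y,
    `|x - gam| < rho -> `|y - lam| < rho -> forall a : nat -> bool,
    `|psum (bits a) x - psum (bits (face gam lam)) x - (a 0%N)%:R| <= 1 / 8 \/
    height x y a <= height x y (face gam lam) - nu].
Proof.
move=> hg hl gl gNl; set m := face gam lam.
have [q [r [q0 q1 r0 gq lq]]] := common_radius _ _ hg hl.
have q1' : 0 < 1 - q by rewrite subr_gt0.
have [K Kq] : exists K, q ^+ K.+1 / (1 - q) <= 1 / 8.
  have cv : geometric (1 - q)^-1 q @ \oo --> (0 : R).
    by apply: cvg_geometric; rewrite ger0_norm.
  have : \forall n \near \oo, geometric (1 - q)^-1 q n < 1 / 8.
    by apply: (cvgr_lt _ cv); rewrite divr_gt0.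
  by case=> n _ /(_ n.+1 (leqnSn n)) /ltW lt; exists n; rewrite mulrC.
have [mu mu0 mule] : exists2 mu, 0 < mu & forall i, (i < K)%N ->
    mu <= `|gam ^+ i.+1 - lam ^+ i.+1|.
  apply: (positive_lower_bound (fun i => `|gam ^+ i.+1 - lam ^+ i.+1|)) => i.
  rewrite normr_gt0 subr_eq0; apply/eqP => /eqr_exp_norm /eqP.
  by rewrite eqr_norm2 (negbTE gl) (negbTE gNl).
pose rho := Num.min r (mu / 8 * (1 - q) * (1 - q)).
have rho1 : rho <= r by rewrite ge_min lexx.
have rho2 : rho / (1 - q) / (1 - q) <= mu / 8.
  by rewrite !ler_pdivrMr// ge_min lexx orbT.
exists rho, (mu / 2); split.
- by rewrite lt_min r0 !mulr_gt0// divr_gt0.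
- by rewrite divr_gt0.
move=> x y xg yl a.
have hxq := gq x (lt_le_trans xg rho1); have hyq := lq y (lt_le_trans yl rho1).
have hgq : `|gam| <= q by apply: gq; rewrite subrr normr0.
have hlq : `|lam| <= q by apply: lq; rewrite subrr normr0.
have [/existsP[i ai]|] := boolP [exists i : 'I_K, a i.+1 != m i.+1]; last first.
  rewrite negb_exists => /forallP am; left.
  have am' i : (i < K)%N -> a i.+1 = m i.+1.
    by move=> iK; have := am (Ordinal iK); rewrite negbK => /eqP.
  have := agree_tail x q K a m hxq q1 am'.
  by rewrite {4}/bits subr0 => /le_trans; apply.
right; have drop := height_drop gam lam a i hg hl ai.
have pert c : `|height x y c - height gam lam c| <= mu / 4.
  have := height_lipschitz gam lam x y q rho c q1 hxq hgq hyq hlq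
    (ltW xg) (ltW yl).
  by move=> /le_trans; apply; clear -rho2; lra.
have /ler_normlP[_ pa] := pert a; have /ler_normlP[pm _] := pert m.
have mui := mule i (ltn_ord i).
rewrite -/m in drop; clear -pa pm mui drop; lra.
Qed.

(** Coordinates: the value at [x] is the horizontal coordinate and the height
    the vertical one, so that [(1, 1)] becomes [(1, 0)] and the target
    [(1/2, 1/2)] becomes [(1/2, 0)]. *)
Lemma transversal_trap gam lam : `|gam| < 1 -> `|lam| < 1 ->
  gam != lam -> gam != - lam -> trap gam lam (1 / 2) (1 / 2).
Proof.
move=> hg hl gl gNl.
have [rho0 [nu [rho00 nu0 isol]]] := face_isolated gam lam hg hl gl gNl.
set m := face gam lam in isol.
pose rho := Num.min rho0 (Num.min (1 / 16) (nu / 2)).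
have rho1 : rho <= rho0 by rewrite !ge_min lexx.
have rho2 : rho <= 1 / 16 by rewrite !ge_min lexx orbT.
have rho3 : rho <= nu / 2 by rewrite !ge_min lexx !orbT.
exists rho, 8, (1 / 32); split.
- by rewrite !lt_min rho00 !divr_gt0.
- by rewrite ler0n.
- by rewrite divr_gt0.
move=> x y u v hx hy xg yl uw vw e /andP[e0 e1] nz.
(* The other sequence of maximal height for [gam] and [lam]. *)
pose m1 := bcons true (fun n => m n.+1).
have mE : m = bcons false (fun n => m n.+1) by apply/funext => -[].
have m1X z : `|z| < 1 -> psum (bits m1) z = psum (bits m) z + 1.
  by move=> hz; rewrite mE /m1 !psum_bcons// add0r addrC.
have [s ps ls] := near_zero_linked x y e m m1 e0 hx hy nz.
pose p i := nth m (m :: s) i.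
pose P i := (psum (bits (p i)) x, height x y (p i)).
have pk : p (size s) = m1 by rewrite -ls (last_nth m).
have [i [j []]] : exists i j,
    `|(P i).1 - (P j).1 - u| <= 2 * (2 * e) /\
    `|(P i).2 - (P j).2 - (u - v)| <= 2 * (2 * e).
  apply: (chain_meets_translate (size s) P (u, u - v) (2 * e) nu) => /=.
  - by clear -e1; lra.
  - exact: le_trans (ltW uw) rho2.
  - rewrite (_ : u - v = (u - 1 / 2) - (v - 1 / 2)); last by ring.
    apply: le_lt_trans (ler_normB _ _) _.
    by clear -uw vw rho3; lra.
  - move=> i ik; have := pathP m ps i ik; rewrite close_sym => /andP[s1 s2].
    split; first by apply: le_trans s1 _; clear -e0; lra.
    rewrite /height (_ : _ - _ = (psum (bits (p i.+1)) x - psum (bits (p i)) x)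
      - (psum (bits (p i.+1)) y - psum (bits (p i)) y)); last by ring.
    apply: le_trans (ler_normB _ _) _.
    by rewrite mulr2n mulrDl mul1r lerD.
  - by rewrite pk m1X.
  - by rewrite pk /height !m1X// opprD addrACA subrr addr0.
  move=> i; have [+|] := isol x y (lt_le_trans xg rho1) (lt_le_trans yl rho1) (p i).
    by case: (p i 0%N) => ?; [apply: Or32|apply: Or31; rewrite -[X in `|X|]subr0].
  by move=> ?; apply: Or33.
move=> f1 f2.
exists (fun n => bits (p i) n - bits (p j) n); split.
- exact: ternary_bitsB.
- rewrite psumB//; [|exact: unit_bounded_bits..].
  by apply: le_trans f1 _; clear -e0; lra.
rewrite psumB//; [|exact: unit_bounded_bits..].
rewrite (_ : _ - v = ((P i).1 - (P j).1 - u) - ((P i).2 - (P j).2 - (u - v))).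
  by apply: le_trans (ler_normB _ _) _; clear -f1 f2; lra.
by rewrite /P /height /=; ring.
Qed.

(** Adding the equations at [gam] and [- gam] leaves a series in the square [s]
    of [gam], with constant term 1 and coefficients in {-1, 0, 1}.  It can only
    vanish if the geometric series [s + s^2 + ...] reaches 1. *)
Lemma antidiagonal_zero_sqr_ge gam (a : R^nat) : `|gam| < 1 -> classB a ->
  psum a gam = 0 -> psum a (- gam) = 0 -> 1 / 2 <= gam ^+ 2.
Proof.
move=> hg aB z1 z2.
have ab := ternary_unit_bounded _ (classB_ternary _ aB).
have hgN : `|- gam| < 1 by rewrite normrN.
pose E n := psum (tail n.*2 a) gam + psum (tail n.*2 a) (- gam).
have tb n : unit_bounded (tail n a) by exact: unit_bounded_tail.
have rec n : E n = 2 * a n.*2 + gam ^+ 2 * E n.+1.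
  rewrite /E doubleS !(psum_tail n.*2)// !(psum_tail n.*2.+1)//.
  by ring.
have g2 : 0 <= gam ^+ 2 < 1.
  by rewrite sqr_ge0 -[gam ^+ 2]ger0_norm ?sqr_ge0// normrX exprn_ilt1.
have bd : `|E 1%N| <= 2 / (1 - gam ^+ 2).
  apply: (contraction_le (fun n => `|E n.+1|) _ _
     ((1 - `|gam|)^-1 + (1 - `|gam|)^-1)) => // n.
    apply: le_trans (ler_normD _ _) _; apply: lerD.
      exact: psum_norm_le.
    by rewrite -(normrN gam); exact: psum_norm_le.
  rewrite rec; apply: le_trans (ler_normD _ _) _.
  rewrite (normrM (gam ^+ 2)) (ger0_norm (sqr_ge0 gam)) lerD2r.
  by rewrite normrM ger0_norm// ler_piMr// ab.
have E0 : E 0%N = 0.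
  by rewrite /E (_ : tail 0.*2 a = a) ?z1 ?z2 ?addr0.
have := rec 0%N; rewrite E0 aB.1 mulr1 => eq2.
have : gam ^+ 2 * `|E 1%N| = 2.
  rewrite -{1}[gam ^+ 2]ger0_norm ?sqr_ge0// -normrM.
  by rewrite (_ : _ * _ = - 2) ?normrN ?ger0_norm//; lra.
move=> eq3; case/andP: g2 => g0 g1.
have : 2 <= gam ^+ 2 * (2 / (1 - gam ^+ 2)) by rewrite -{1}eq3 ler_wpM2l.
rewrite mulrA ler_pdivlMr ?subr_gt0//; lra.
Qed.

(** In the coordinates [x + y] and [y - x], multiplication by [gam] and [- gam]
    exchanges the axes and scales by [gam], up to signs, while a digit only
    moves the first coordinate.  So greedy digits map the rectangle [K] into
    itself; its half-sides 3 and 2 leave some room in both directions as long as the inverse of [gam]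
    is at most [sqrt 2], and the room absorbs a perturbation by [1/100]. *)
Lemma antidiagonal_trap gam : 1 / 2 <= gam ^+ 2 -> trap gam (- gam) 0 0.
Proof.
move=> g2; exists (1 / 100), 0, 1; split => //.
move=> x y u v hx hy xg yg; rewrite !subr0 => hu hv e _ _.
have g7 : 7 / 10 <= `|gam|.
  have : gam ^+ 2 = `|gam| ^+ 2 by rewrite -normrX ger0_norm ?sqr_ge0.
  have := normr_ge0 gam; rewrite expr2 => ? eq; nra.
have hx69 : 69 / 100 <= `|x|.
  by have := ler_normD (gam - x) x; rewrite subrK distrC; lra.
have hy69 : 69 / 100 <= `|y|.
  have := ler_normD (- gam - y) y; rewrite subrK distrC normrN; lra.
have x0 : x != 0 by rewrite -normr_gt0; lra.
have y0 : y != 0 by rewrite -normr_gt0; lra.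
pose K : set (R * R) := [set p | `|p.1 + p.2| <= 3 /\ `|p.2 - p.1| <= 2].
have KB p : K p -> `|p.1| <= 5 / 2 /\ `|p.2| <= 5 / 2.
  move=> [/ler_normlP[s1 s2] /ler_normlP[d1 d2]].
  by clear -s1 s2 d1 d2; split; apply/ler_normlP; split; lra.
have Kstep p : K p -> exists d, d \in [:: -1; 0; 1] /\
    K ((p.1 - d) / x, (p.2 - d) / y).
  move=> [/ler_normlP[s1 s2] d12].
  have [d [dP dh]] : exists d : R, d \in [:: -1; 0; 1] /\
      `|(p.1 - d) + (p.2 - d)| <= 1.
    clear -s1 s2; have [h1|h1] := ltP (p.1 + p.2) (-1).
      by exists (-1); rewrite !inE eqxx; split=> //; apply/ler_normlP; split; lra.
    have [h2|h2] := ltP 1 (p.1 + p.2).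
      by exists 1; rewrite !inE eqxx !orbT; split=> //; apply/ler_normlP; split; lra.
    by exists 0; rewrite !inE eqxx !orbT; split=> //; apply/ler_normlP; split; lra.
  exists d; split => //; rewrite /K /=.
  set S := _ + (p.2 - d) in dh; set D := p.2 - p.1 in d12.
  have inv45 (z : R) : 69 / 100 <= `|z| -> `|z^-1| <= 29 / 20.
    by clear => hz; rewrite normfV -[29 / 20]invrK lef_pV2 ?posrE; lra.
  have ix := inv45 x hx69; have iy := inv45 y hy69.
  have ixy : `|x^-1 + y^-1| <= 1 / 20.
    rewrite (_ : x^-1 + y^-1 = (x + y) * x^-1 * y^-1); last first.
      by field; rewrite x0 y0.
    have hxy : `|x + y| <= 1 / 50.
      rewrite (_ : x + y = (x - gam) + (y - - gam)); last by ring.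
      by apply: le_trans (ler_normD _ _) _; lra.
    rewrite !normrM.
    apply: (@le_trans _ _ (1 / 50 * (29 / 20) * (29 / 20))); last by lra.
    by apply: ler_pM => //; apply: ler_pM.
  have ixNy : `|x^-1 - y^-1| <= 29 / 10.
    by apply: le_trans (ler_normB _ _) _; lra.
  split.
    rewrite (_ : _ + _ = (x^-1 + y^-1) * S / 2 - (x^-1 - y^-1) * D / 2); last first.
      by rewrite /S /D; lra.
    apply: le_trans (ler_normB _ _) _; rewrite !normrM normfV (@ger0_norm _ 2)//.
    have : `|x^-1 + y^-1| * `|S| <= 1 / 20 * 1 by exact: ler_pM.
    have : `|x^-1 - y^-1| * `|D| <= 29 / 10 * 2 by exact: ler_pM.
    by lra.
  rewrite (_ : _ - _ = (x^-1 + y^-1) * D / 2 - (x^-1 - y^-1) * S / 2); last first.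
    by rewrite /S /D; lra.
  apply: le_trans (ler_normB _ _) _; rewrite !normrM normfV (@ger0_norm _ 2)//.
  have : `|x^-1 + y^-1| * `|D| <= 1 / 20 * 2 by exact: ler_pM.
  have : `|x^-1 - y^-1| * `|S| <= 29 / 10 * 1 by exact: ler_pM.
  by lra.
have K0 : K (u, v).
  move: hu hv; rewrite !ltr_norml => /andP[? ?] /andP[? ?].
  by split; apply/ler_normlP => /=; split; lra.
have [h [ht h1 h2]] := self_covering_expansion K x y _ x0 y0 hx hy KB Kstep _ K0.
by exists h; rewrite h1 h2 /= !subrr normr0 mul0r; split.
Qed.

(** * From traps to interior points *)
Definition graft g n h : R^nat :=
  fun i => if (i <= n)%N then g i else h (i - n.+1)%N.

Lemma classB_graft g n h : classB g -> ternary h -> classB (graft g n h).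
Proof.
move=> gB hh; split; first by rewrite /graft leq0n; exact: gB.1.
move=> k; rewrite /graft; case: ifP => _; first exact: gB.2.
exact: hh.
Qed.

Lemma psum_graft g n h x : classB g -> ternary h -> `|x| < 1 ->
  psum (graft g n h) x = (truncp g n).[x] + x ^+ n.+1 * psum h x.
Proof.
move=> gB hh hx.
have gu := ternary_unit_bounded _ (classB_ternary _ (classB_graft g n h gB hh)).
rewrite (psum_truncp _ n)//; congr (_ + _ * psum _ _).
  rewrite /truncp !horner_poly; apply: eq_bigr => i _.
  by rewrite /graft -ltnS ltn_ord.
by apply/funext => k; rewrite /tail /graft leqNgt leq_addr/= addKn.
Qed.

(** Bootstrap step: the ternary series provided by a trap replaces the tail of
    [g], and its error [C e] is damped by the factor [q^(n+1)]. *)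
Lemma near_zero_half g n x y q (C : R) e (u v : R) :
  classB g -> `|x| < 1 -> `|y| < 1 -> `|x| <= q -> `|y| <= q -> 0 <= e ->
  q ^+ n.+1 * C <= 1 / 2 ->
  (truncp g n).[x] = - (x ^+ n.+1 * u) -> (truncp g n).[y] = - (y ^+ n.+1 * v) ->
  (exists h, [/\ ternary h, `|psum h x - u| <= C * e & `|psum h y - v| <= C * e]) ->
  near_zero x y (e / 2).
Proof.
move=> gB hx hy hxq hyq e0 qC gx gy [h [hh hu hv]].
have q0 : 0 <= q by exact: le_trans hxq.
have main z c : `|z| < 1 -> `|z| <= q -> (truncp g n).[z] = - (z ^+ n.+1 * c) ->
    `|psum h z - c| <= C * e -> `|psum (graft g n h) z| <= e / 2.
  move=> hz hzq gz hc; rewrite psum_graft// gz addrC -mulrBr normrM normrX.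
  apply: (@le_trans _ _ (q ^+ n.+1 * (C * e))).
    by apply: ler_pM; rewrite ?exprn_ge0// lerXn2r// nnegrE.
  by rewrite mulrA [e / 2]mulrC -[2^-1]mul1r ler_wpM2r.
by exists (graft g n h); split; [exact: classB_graft|exact: main hu|exact: main hv].
Qed.

Lemma sign_change_near (f : R -> R) (l r : R) : sign_change f l -> 0 < r ->
  exists s t, [/\ l - r < s, s < l, l < t, t < l + r & f s * f t < 0].
Proof.
move=> sc r0.
have lN : l - r < l by rewrite ltrBlDr ltrDl.
have lP : l < l + r by rewrite ltrDl.
have pick_left (P : set R) : (\forall s \near l^'-, P s) ->
    exists s, [/\ P s, l - r < s & s < l].
  move=> hP; near (at_left l) => s; exists s; split; near: s => //.
  - exact: nbhs_left_gt.
  - exact: nbhs_left_lt.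
have pick_right (P : set R) : (\forall t \near l^'+, P t) ->
    exists t, [/\ P t, l < t & t < l + r].
  move=> hP; near (at_right l) => t; exists t; split; near: t => //.
  - exact: nbhs_right_gt.
  - exact: nbhs_right_lt.
by case: sc => -[/pick_left[s [fs s1 s2]] /pick_right[t [ft t1 t2]]]; exists s, t; split=> //;
  rewrite ?(nmulr_rlt0 _ fs) ?(pmulr_rlt0 _ fs).
Unshelve. all: by end_near.
Qed.

Lemma perturbed_truncation_cvg g x (w : R) : classB g -> `|x| < 1 ->
  (fun n => (truncp g n + w *: 'X^(n.+1)).[x]) @ \oo --> psum g x.
Proof.
move=> gB hx.
have gu := ternary_unit_bounded _ (classB_ternary _ gB).
have -> : (fun n => (truncp g n + w *: 'X^(n.+1)).[x]) =
    (fun n => pseries g x n.+1 + geometric w x n.+1).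
  apply/funext => n; rewrite hornerD hornerZ hornerXn; congr (_ + _).
  by rewrite /truncp horner_poly /pseries /series /= big_mkord.
rewrite -[psum g x]addr0; apply: cvgD.
  by rewrite (cvg_shiftS (pseries g x)); exact: is_cvg_psum.
by rewrite (cvg_shiftS (geometric w x)); exact: cvg_geometric.
Qed.

(** The perturbed truncations converge to [psum g] at two points on either side
    of [gam] where [psum g] has opposite signs; the intermediate value theorem
    applies to them as polynomials. *)
Lemma sign_change_perturbed_root g gam (w r : R) : classB g -> `|gam| < 1 ->
  0 < r -> sign_change (psum g) gam ->
  \forall n \near \oo, exists2 x, `|x - gam| < r &
    (truncp g n).[x] = - (x ^+ n.+1 * w).
Proof.
move=> gB hg r0 sc; move: (hg); rewrite ltr_norml => /andP[g1 g2].
pose r' := Num.min r (1 - `|gam|).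
have r'0 : 0 < r' by rewrite lt_min r0 subr_gt0.
have r'r : r' <= r by rewrite ge_min lexx.
have r'g : r' <= 1 - `|gam| by rewrite ge_min lexx orbT.
have [s [t [s1 s2 t1 t2 st]]] := sign_change_near _ _ _ sc r'0.
have near1 z : gam - r' < z -> z < gam + r' -> `|z| < 1.
  move=> z1 z2; have := ler_norm gam; have := ler_norm (- gam); rewrite normrN.
  by clear -z1 z2 r'g => ? ?; rewrite ltr_norml; apply/andP; split; lra.
have hs : `|s| < 1 by apply: near1 => //; clear -s2 r'0; lra.
have ht : `|t| < 1 by apply: near1 => //; clear -t1 r'0; lra.
have cvp : (fun n => (truncp g n + w *: 'X^(n.+1)).[s] *
    (truncp g n + w *: 'X^(n.+1)).[t]) @ \oo --> psum g s * psum g t.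
  by apply: cvgM; exact: perturbed_truncation_cvg.
have : \forall n \near \oo, (truncp g n + w *: 'X^(n.+1)).[s] *
    (truncp g n + w *: 'X^(n.+1)).[t] < 0 by exact: (cvgr_lt _ cvp).
apply: filterS => n; set P := _ + _ => Pst.
suff [x /andP[x1 x2] /rootP] : exists2 x, s <= x <= t & root P x.
  rewrite hornerD hornerZ hornerXn => Px; exists x.
    by clear -x1 x2 s1 t2 r'r; rewrite ltr_norml; apply/andP; split; lra.
  by apply/eqP; rewrite -addr_eq0 mulrC Px.
have st' : s <= t by clear -s2 t1; lra.
have [Ps|Ps] := leP P.[s] 0.
  apply: poly_ivt => //; rewrite Ps /=.
  by rewrite leNgt; apply/negP => Pt; move: Pst; rewrite ltNge mulr_le0// ltW.
have [x xst] : exists2 x, s <= x <= t & root (- P) x.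
  apply: poly_ivt => //; rewrite !hornerN oppr_le0 oppr_ge0 (ltW Ps) /=.
  by move: Pst; rewrite pmulr_rlt0// => /ltW.
by rewrite rootN; exists x.
Qed.

(** The two last conditions on [(x, y)] say that the values which the tail must
    take at [x] and [y] in order to cancel [truncp g n] are admissible
    targets.  The bootstrap can start because [g] itself is small near its
    zeros. *)
Lemma trap_setN g gam lam (w1 w2 : R) : classB g -> `|gam| < 1 -> `|lam| < 1 ->
  psum g gam = 0 -> psum g lam = 0 -> trap gam lam w1 w2 ->
  exists rho, [/\ 0 < rho, rho <= `|gam|, rho <= `|lam| &
    \forall n \near \oo, forall x y, `|x - gam| < rho -> `|y - lam| < rho ->
    `|- ((truncp g n).[x] / x ^+ n.+1) - w1| < rho ->
    `|- ((truncp g n).[y] / y ^+ n.+1) - w2| < rho -> setN R (x, y)].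
Proof.
move=> gB hg hl zg zl [rho0 [C [e0 [rho00 C0 e00 tr]]]].
have gu := ternary_unit_bounded _ (classB_ternary _ gB).
have nz z : `|z| < 1 -> psum g z = 0 -> z != 0.
  move=> hz; apply: contra_eqN => /eqP->.
  by rewrite psum_recl ?normr0// mul0r addr0 gB.1 oner_eq0.
have [q [r [q0 q1 r0 gq lq]]] := common_radius _ _ hg hl.
have q1' : 0 < 1 - q by rewrite subr_gt0.
pose rho := Num.min (Num.min rho0 (Num.min `|gam| `|lam|))
                    (Num.min r (e0 * (1 - q) * (1 - q))).
have rho1 : rho <= rho0 by rewrite !ge_min lexx.
have rho2 : rho <= `|gam| by rewrite !ge_min lexx !orbT.
have rho3 : rho <= `|lam| by rewrite !ge_min lexx !orbT.
have rho4 : rho <= r by rewrite !ge_min lexx !orbT.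
have rho5 : rho / (1 - q) / (1 - q) <= e0.
  by rewrite !ler_pdivrMr// !ge_min lexx !orbT.
exists rho; split=> //.
  by rewrite !lt_min rho00 !normr_gt0 !nz// r0 !mulr_gt0.
have cv : (fun n => geometric C q n.+1) @ \oo --> (0 : R).
  by rewrite (cvg_shiftS (geometric C q)); apply: cvg_geometric; rewrite ger0_norm.
have half0 : (0 : R) < 1 / 2 by rewrite divr_gt0.
have : \forall n \near \oo, C * q ^+ n.+1 < 1 / 2 by exact: (cvgr_lt _ cv).
apply: filterS => n /ltW qn x y xg yl ux vy.
have near_facts z z' : `|z'| <= q -> `|z| <= q -> psum g z' = 0 -> rho <= `|z'| ->
    `|z - z'| < rho -> z != 0 /\ `|psum g z| <= e0.
  move=> hz' hz gz' rz zz'; split.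
    by apply: contraTneq zz' => ->; rewrite sub0r normrN -leNgt.
  rewrite -[psum g z]subr0 -gz'; apply: le_trans rho5.
  exact: psum_lipschitz_le gu q1 hz hz' (ltW zz').
have hxq := gq x (lt_le_trans xg rho4); have hyq := lq y (lt_le_trans yl rho4).
have hgq : `|gam| <= q by apply: gq; rewrite subrr normr0.
have hlq : `|lam| <= q by apply: lq; rewrite subrr normr0.
have [x0 gx] := near_facts x gam hgq hxq zg rho2 xg.
have [y0 gy] := near_facts y lam hlq hyq zl rho3 yl.
have hx : `|x| < 1 by exact: le_lt_trans q1.
have hy : `|y| < 1 by exact: le_lt_trans q1.
apply: (setN_of_halving x y e0) => //; first by exists g.
move=> e ee0 nze; have e_ge0 : 0 <= e by case/andP: ee0 => /ltW.
apply: (near_zero_half g n x y q C e _ _ gB hx hy hxq hyq e_ge0 _ _ _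
  (tr x y _ _ hx hy (lt_le_trans xg rho1) (lt_le_trans yl rho1)
     (lt_le_trans ux rho1) (lt_le_trans vy rho1) e ee0 nze)).
- by rewrite mulrC.
- by rewrite mulrN opprK mulrCA mulfV ?mulr1// expf_neq0.
- by rewrite mulrN opprK mulrCA mulfV ?mulr1// expf_neq0.
Qed.

(** At the pair [(x, y)] of roots of the perturbed truncations the targets are
    exactly [(w1, w2)]; by continuity the conditions of [trap_setN] hold on a
    neighbourhood of [(x, y)]. *)
Lemma trap_closure_interior g gam lam (w1 w2 : R) : classB g ->
  `|gam| < 1 -> `|lam| < 1 -> psum g gam = 0 -> psum g lam = 0 ->
  sign_change (psum g) gam -> sign_change (psum g) lam ->
  trap gam lam w1 w2 -> closure (interior (setN R)) (gam, lam).
Proof.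
move=> gB hg hl zg zl sg sl tr B [[A1 A2] /= [nA1 nA2] AB].
have [rho [rho0 rhog rhol big]] := trap_setN g gam lam w1 w2 gB hg hl zg zl tr.
move: nA1 nA2 => /nbhs_ballP[r1 /= r10 b1] /nbhs_ballP[r2 /= r20 b2].
pose r := Num.min rho (Num.min r1 r2).
have r0 : 0 < r by rewrite !lt_min rho0 r10.
case: big => N1 _ big.
have [N2 _ rootx] := sign_change_perturbed_root g gam w1 r gB hg r0 sg.
have [N3 _ rooty] := sign_change_perturbed_root g lam w2 r gB hl r0 sl.
pose n := maxn N1 (maxn N2 N3).
have inN := big n (leq_maxl _ _).
have [|x xr gx] := rootx n; first by rewrite /= !leq_max leqnn orbT.
have [|y yr gy] := rooty n; first by rewrite /= !leq_max leqnn !orbT.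
have xg : `|x - gam| < rho by apply: lt_le_trans xr _; rewrite ge_min lexx.
have yl : `|y - lam| < rho by apply: lt_le_trans yr _; rewrite ge_min lexx.
have x0 : x != 0.
  by apply: contraTneq xg => ->; rewrite sub0r normrN -leNgt.
have y0 : y != 0.
  by apply: contraTneq yl => ->; rewrite sub0r normrN -leNgt.
have good z z' w : z != 0 -> `|z - z'| < rho ->
    (truncp g n).[z] = - (z ^+ n.+1 * w) ->
    \forall t \near z, `|t - z'| < rho /\
      `|- ((truncp g n).[t] / t ^+ n.+1) - w| < rho.
  move=> z0 zz' gz.
  have d : (fun t : R => `|t - z'|) @ z --> `|z - z'|.
    by apply: cvg_norm; apply: cvgB; [exact: cvg_id|exact: cvg_cst].
  have c : (fun t : R => `|- ((truncp g n).[t] / t ^+ n.+1) - w|) @ z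
      --> `|- ((truncp g n).[z] / z ^+ n.+1) - w|.
    apply: cvg_norm; apply: cvgB; last exact: cvg_cst.
    apply: cvgN; apply: cvgM; first exact: continuous_horner.
    apply: cvgV; first exact: expf_neq0.
    exact: exprn_continuous.
  have gz0 : `|- ((truncp g n).[z] / z ^+ n.+1) - w| < rho.
    by rewrite gz mulNr opprK [z ^+ _ * w]mulrC mulfK ?expf_neq0// subrr normr0.
  by apply: filterS2 (cvgr_lt _ d _ zz') (cvgr_lt _ c _ gz0) => t.
exists (x, y); split; last first.
  apply: AB; split=> /=; [apply: b1|apply: b2]; rewrite -ball_normE /= distrC.
  - by apply: lt_le_trans xr _; rewrite !ge_min lexx orbT.
  - by apply: lt_le_trans yr _; rewrite !ge_min lexx !orbT.
exists ([set t | `|t - gam| < rho /\ `|- ((truncp g n).[t] / t ^+ n.+1) - w1| < rho],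
        [set t | `|t - lam| < rho /\ `|- ((truncp g n).[t] / t ^+ n.+1) - w2| < rho]).
  by split; [exact: good xg gx|exact: good yl gy].
by move=> [t1 t2] /= [[? ?] [? ?]]; apply: inN.
Qed.

End SignChangePairs.

Theorem theorem5p10 (R : realType) :
  setN'_U R `\` Diag R `<=` closure (interior (setN R)).
Proof.
move=> [gam lam] [[[sq [g [gB zg zl sg sl]]] _] ndiag].
have [hg hl] : `|gam| < 1 /\ `|lam| < 1.
  by move: sq => [/=]; rewrite !in_itv/= !ltr_norml.
have gl : gam != lam.
  by apply/eqP => gl; apply: ndiag.
have [gNl|gNl] := eqVneq lam (- gam); last first.
  apply: (trap_closure_interior R g gam lam _ _ gB hg hl zg zl sg sl
    (transversal_trap R gam lam hg hl gl _)).
  by apply: contraNneq gNl => ->; rewrite opprK.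
move: zl sl hl gl; rewrite /= gNl => zl sl hl _ {sq ndiag gNl}.
apply: (trap_closure_interior R g gam (- gam) _ _ gB hg hl zg zl sg sl).
apply: antidiagonal_trap.
exact: (antidiagonal_zero_sqr_ge R gam g).
Qed.
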